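(* Let $k\le \min\{n,p\}$ and assume that the joint bidiagonalization process applied to $\{A,L\}$ with starting vector $b$ (described in the context) does not break down at iteration $k$. Let $B_k\in\mathbb{R}^{(k+1)\times k}$ and $\bar B_k\in\mathbb{R}^{k\times k}$ be the bidiagonal matrices it produces, let $\beta_1=\|b\|$, and let $e_1$ be the first canonical vector of $\mathbb{R}^{k+1}$. Then the solution $y_k$ of the constrained problem $$\min\|\bar B_k y\|\quad\text{subject to}\quad y\in\Big\{y\in\mathbb{R}^k \;\Big|\; \|B_k y-\beta_1e_1\|=\min_{z\in\mathbb{R}^k}\|B_kz-\beta_1e_1\|\Big\}$$ is $$y_k=\arg\min_{y\in\mathbb{R}^k}\|B_ky-\beta_1e_1\|=\beta_1B_k^{\dagger}e_1 .$$
   Context: $\|\cdot\|$ is the Euclidean norm and $\dagger$ the Moore–Penrose inverse. $A\in\mathbb{R}^{m\times n}$, $L\in\mathbb{R}^{p\times n}$, $m\ge n$, $\mathcal N(A)\cap\mathcal N(L)=\{\mathbf 0\}$, and $b\in\mathbb{R}^m$ is nonzero. Let $\begin{pmatrix}A\\L\end{pmatrix}=QR$ be the compact QR factorization, $Q=\begin{pmatrix}Q_A\\Q_L\end{pmatrix}$ with orthonormal columns, $Q_A\in\mathbb{R}^{m\times n}$, $Q_L\in\mathbb{R}^{p\times n}$, and $R\in\mathbb{R}^{n\times n}$ nonsingular upper triangular. Joint bidiagonalization process: set $\beta_1u_1=b$ with $\beta_1=\|b\|$, $\alpha_1v_1=Q_A^Tu_1$, $\widehat\alpha_1\widehat u_1=Q_Lv_1$,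 and for $i=1,2,\dots$ $$\beta_{i+1}u_{i+1}=Q_Av_i-\alpha_iu_i,\quad \alpha_{i+1}v_{i+1}=Q_A^Tu_{i+1}-\beta_{i+1}v_i,\quad \widehat\beta_i=\frac{\alpha_{i+1}\beta_{i+1}}{\widehat\alpha_i},\quad \widehat\alpha_{i+1}\widehat u_{i+1}=(-1)^iQ_Lv_{i+1}-\widehat\beta_i\widehat u_i,$$ where $\alpha_i,\beta_i,\widehat\alpha_i\ge 0$ are chosen so that $u_i,v_i,\widehat u_i$ have unit norm. $B_k\in\mathbb{R}^{(k+1)\times k}$ is lower bidiagonal with diagonal entries $\alpha_1,\dots,\alpha_k$ and subdiagonal entries $\beta_2,\dots,\beta_{k+1}$. $\widehat B_k\in\mathbb{R}^{k\times k}$ is upper bidiagonal with diagonal entries $\widehat\alpha_1,\dots,\widehat\alpha_k$ and superdiagonal entries $\widehat\beta_1,\dots,\widehat\beta_{k-1}$. $\bar B_k=\widehat B_kD_k$ with $D_k=\mathrm{diag}(1,-1,1,-1,\dots)\in\mathbb{R}^{k\times k}$. ''The process does not break down at iteration $k$'' means that the normalizing coefficients $\alpha_1,\dots,\alpha_k$, $\beta_1,\dots,\beta_k$, $\widehat\alpha_1,\dots,\widehat\alpha_k$ are all nonzero. *)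

(* Defs.v *)
From mathcomp Require Export all_boot all_order all_algebra.
From mathcomp Require Export classical_sets reals.

Set Implicit Arguments.
Unset Strict Implicit.
Unset Printing Implicit Defensive.

Import Order.TTheory GRing.Theory Num.Theory.

Local Open Scope classical_set_scope.
Local Open Scope ring_scope.

(* The norm that MathComp-Analysis puts on matrices is the sup norm. *)
Definition enorm (R : realType) (n : nat) (x : 'cV[R]_n) : R :=
  Num.sqrt (\sum_(i < n) x i ord0 ^+ 2).

Definition argmin (R : realType) (T : Type) (S : set T) (f : T -> R) : set T :=
  [set y | S y /\ forall z, S z -> f y <= f z].

Definition penrose (R : realType) (m n : nat) (A : 'M[R]_(m, n))
    (X : 'M[R]_(n, m)) : Prop :=
  [/\ A *m X *m A = A, X *m A *m X = X,
      (A *m X)^T = A *m X & (X *m A)^T = X *m A].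

(* The default value 0 is never used: see mpinvP and penrose_uniq. *)
Definition mpinv (R : realType) (m n : nat) (A : 'M[R]_(m, n)) : 'M[R]_(n, m) :=
  xget 0 [set X | penrose A X].

Lemma gram_unit (R : realType) (r n : nat) (F : 'M[R]_(r, n)) :
  row_free F -> F *m F^T \in unitmx.
Proof.
move=> Ffree; rewrite -row_free_unit; apply: inj_row_free => v.
rewrite mulmxA => vFF0.
apply: (row_free_inj Ffree); rewrite mul0mx.
have: (v *m F) *m (v *m F)^T = 0 by rewrite trmx_mul mulmxA vFF0 mul0mx.
move: (v *m F) => w /matrixP /(_ 0 0); rewrite !mxE => w0.
have {}w0 : \sum_(j < n) w 0 j ^+ 2 = 0.
  by rewrite -[RHS]w0; apply: eq_bigr => j _; rewrite !mxE expr2.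
apply/rowP => j; rewrite mxE; apply/eqP; rewrite -sqrf_eq0; apply/eqP.
by apply: (psumr_eq0P _ w0) => // i _; rewrite sqr_ge0.
Qed.

Lemma penrose_exists (R : realType) (m n : nat) (A : 'M[R]_(m, n)) :
  exists X, penrose A X.
Proof.
rewrite -(mulmx_base A).
move: (row_base_free A) (col_base_full A); move: (col_base A) (row_base A).
move: (\rank A) => r C F Ffree Cfull.
have uF := gram_unit Ffree.
have uC : C^T *m C \in unitmx.
  rewrite -{2}(trmxK C); apply: gram_unit.
  by rewrite /row_free mxrank_tr; exact: Cfull.
set P := invmx (F *m F^T); set Q := invmx (C^T *m C).
have PT : P^T = P by rewrite /P trmx_inv trmx_mul trmxK.
have QT : Q^T = Q by rewrite /Q trmx_inv trmx_mul trmxK.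
have AX : C *m F *m (F^T *m P *m Q *m C^T) = C *m Q *m C^T.
  by rewrite !mulmxA -(mulmxA C F) -(mulmxA C _ P) mulmxV // mulmx1.
have XA : F^T *m P *m Q *m C^T *m (C *m F) = F^T *m P *m F.
  by rewrite !mulmxA -(mulmxA _ C^T C) -(mulmxA _ Q) mulVmx // mulmx1.
exists (F^T *m P *m Q *m C^T); split.
- by rewrite AX mulmxA -(mulmxA _ C^T C) -(mulmxA _ Q) mulVmx // mulmx1.
- by rewrite XA !mulmxA -(mulmxA _ F F^T) -(mulmxA _ (F *m F^T) P) mulmxV // mulmx1.
- by rewrite AX !trmx_mul trmxK QT mulmxA.
- by rewrite XA !trmx_mul trmxK PT mulmxA.
Qed.

Lemma mpinvP (R : realType) (m n : nat) (A : 'M[R]_(m, n)) :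
  penrose A (mpinv A).
Proof. exact: (xgetPex 0 (penrose_exists A)). Qed.

Lemma penrose_uniq (R : realType) (m n : nat) (A : 'M[R]_(m, n))
    (X Y : 'M[R]_(n, m)) : penrose A X -> penrose A Y -> X = Y.
Proof.
move=> [x1 x2 x3 x4] [y1 y2 y3 y4].
have AXY : A *m X = A *m Y.
  have AYX : A *m Y *m (A *m X) = A *m X by rewrite mulmxA y1.
  by rewrite -x3 -AYX trmx_mul x3 y3 mulmxA x1.
have XYA : X *m A = Y *m A.
  have XAY : X *m A *m (Y *m A) = X *m A by rewrite -mulmxA (mulmxA A) y1.
  by rewrite -x4 -XAY trmx_mul x4 y4 -mulmxA (mulmxA A) x1.
by rewrite -x2 XYA -mulmxA AXY mulmxA y2.
Qed.

Record compact_qr (R : realType) (m p n : nat)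
    (A : 'M[R]_(m, n)) (L : 'M[R]_(p, n))
    (QA : 'M[R]_(m, n)) (QL : 'M[R]_(p, n)) (Rf : 'M[R]_n) : Prop := CompactQR {
  qr_eq : col_mx A L = col_mx QA QL *m Rf;
  qr_orth : (col_mx QA QL)^T *m col_mx QA QL = 1%:M;
  qr_unit : Rf \in unitmx;
  (* is_trig_mx means lower triangular *)
  qr_upper : is_trig_mx Rf^T
}.

(* All sequences are indexed from 1; the entry of index 0 is never used.
   The recurrences are only imposed as far as they are needed to determine
   B_k and \hat B_k: u_1, ..., u_(k+1), v_1, ..., v_k, \hat u_1, ..., \hat u_k.
   When a normalizing coefficient is zero, the corresponding unit vector is
   arbitrary. *)
Record jbd_process (R : realType) (m p n : nat)
    (QA : 'M[R]_(m, n)) (QL : 'M[R]_(p, n)) (b : 'cV[R]_m) (k : nat)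
    (u : nat -> 'cV[R]_m) (v : nat -> 'cV[R]_n) (uh : nat -> 'cV[R]_p)
    (alpha beta alphah betah : nat -> R) : Prop := JbdProcess {
  jbd_beta1 : beta 1%N = enorm b;
  jbd_u1 : beta 1%N *: u 1%N = b;
  jbd_v1 : alpha 1%N *: v 1%N = QA^T *m u 1%N;
  jbd_uh1 : alphah 1%N *: uh 1%N = QL *m v 1%N;
  jbd_u : forall i, (1 <= i <= k)%N ->
    beta i.+1 *: u i.+1 = QA *m v i - alpha i *: u i;
  jbd_v : forall i, (1 <= i < k)%N ->
    alpha i.+1 *: v i.+1 = QA^T *m u i.+1 - beta i.+1 *: v i;
  jbd_betah : forall i, (1 <= i < k)%N ->
    betah i = alpha i.+1 * beta i.+1 / alphah i;
  jbd_uh : forall i, (1 <= i < k)%N ->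
    alphah i.+1 *: uh i.+1 = (-1) ^+ i *: (QL *m v i.+1) - betah i *: uh i;
  jbd_alpha_ge0 : forall i, (1 <= i <= k)%N -> 0 <= alpha i;
  jbd_beta_ge0 : forall i, (1 <= i <= k.+1)%N -> 0 <= beta i;
  jbd_alphah_ge0 : forall i, (1 <= i <= k)%N -> 0 <= alphah i;
  jbd_norm_u : forall i, (1 <= i <= k.+1)%N -> enorm (u i) = 1;
  jbd_norm_v : forall i, (1 <= i <= k)%N -> enorm (v i) = 1;
  jbd_norm_uh : forall i, (1 <= i <= k)%N -> enorm (uh i) = 1
}.

Definition no_breakdown (R : realType) (k : nat) (alpha beta alphah : nat -> R)
    : Prop :=
  forall i, (1 <= i <= k)%N -> [/\ alpha i != 0, beta i != 0 & alphah i != 0].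

(* Matrix indices start at 0, so the entries in column j of B_k are
   alpha_(j+1) and beta_(j+2). *)
Definition Bmx (R : realType) (k : nat) (alpha beta : nat -> R)
    : 'M[R]_(k.+1, k) :=
  \matrix_(i < k.+1, j < k)
    if i == j :> nat then alpha j.+1
    else if i == j.+1 :> nat then beta j.+2 else 0.

Definition Bhmx (R : realType) (k : nat) (alphah betah : nat -> R) : 'M[R]_k :=
  \matrix_(i < k, j < k)
    if i == j :> nat then alphah i.+1
    else if j == i.+1 :> nat then betah i.+1 else 0.

Definition Dmx (R : realType) (k : nat) : 'M[R]_k :=
  diag_mx (\row_(j < k) (-1) ^+ j).

Definition Bbarmx (R : realType) (k : nat) (alphah betah : nat -> R)
    : 'M[R]_k :=
  Bhmx k alphah betah *m Dmx R k.

(* Main.v *)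
Require Import Defs.

(** The matrix [B_k] is lower bidiagonal with the nonzero diagonal entries
    [alpha_1, ..., alpha_k], so it is injective ([Bmx_inj]).  The least squares
    problem [min ||B_k y - beta_1 e_1||] therefore has exactly one solution,
    namely [beta_1 B_k^+ e_1], and a problem constrained to that one-point set
    has the same solution whatever its objective is.

    The least squares part is general ([argmin_lsq_mpinv]): the Penrose
    equations make the residual [B B^+ c - c] orthogonal to the range of [B]
    ([mpinv_normal_eq]), so by Pythagoras
    [||B y - c||^2 = ||B (y - B^+ c)||^2 + ||B B^+ c - c||^2],
    and when [B] is injective the first term vanishes only at [y = B^+ c]. *)

Import Order.TTheory GRing.Theory Num.Theory.

Local Open Scope classical_set_scope.
Local Open Scope ring_scope.

Lemma enorm_ge0 (R : realType) (n : nat) (x : 'cV[R]_n) : 0 <= enorm x.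
Proof. exact: sqrtr_ge0. Qed.

Lemma enorm_sqr (R : realType) (n : nat) (x : 'cV[R]_n) :
  enorm x ^+ 2 = \sum_(i < n) x i ord0 ^+ 2.
Proof. by rewrite sqr_sqrtr // sumr_ge0 // => i _; exact: sqr_ge0. Qed.

Lemma enorm_sqr_eq0 (R : realType) (n : nat) (x : 'cV[R]_n) :
  enorm x ^+ 2 = 0 -> x = 0.
Proof.
rewrite enorm_sqr => x0; apply/colP => i; rewrite mxE.
by apply/eqP; rewrite -sqrf_eq0; apply/eqP;
   apply: (psumr_eq0P _ x0) => // j _; exact: sqr_ge0.
Qed.

Lemma enorm_pythagoras (R : realType) (n : nat) (x y : 'cV[R]_n) :
  x^T *m y = 0 -> enorm (x + y) ^+ 2 = enorm x ^+ 2 + enorm y ^+ 2.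
Proof.
move=> /matrixP /(_ ord0 ord0); rewrite !mxE => xy0.
have {}xy0 : \sum_(i < n) x i ord0 * y i ord0 = 0.
  by rewrite -[RHS]xy0; apply: eq_bigr => i _; rewrite mxE.
rewrite !enorm_sqr (eq_bigr (fun i => x i ord0 ^+ 2 +
  (x i ord0 * y i ord0) *+ 2 + y i ord0 ^+ 2)); last first.
  by move=> i _; rewrite mxE sqrrD.
by rewrite !big_split /= xy0 !addr0.
Qed.

(** [B B^+] is symmetric and fixes the columns of [B], so it is the orthogonal
    projection onto the range of [B]; these are the normal equations. *)
Lemma mpinv_normal_eq (R : realType) (m n : nat) (B : 'M[R]_(m, n))
    (c : 'cV[R]_m) : B^T *m (B *m (mpinv B *m c) - c) = 0.
Proof.
have [BXB _ BXT _] := mpinvP B.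
have BTBX : B^T *m (B *m mpinv B) = B^T by rewrite -BXT -trmx_mul BXB.
by rewrite mulmxBr !mulmxA -(mulmxA B^T) BTBX subrr.
Qed.

Lemma argmin_lsq_mpinv (R : realType) (m n : nat) (B : 'M[R]_(m, n))
    (c : 'cV[R]_m) (Binj : forall y : 'cV[R]_n, B *m y = 0 -> y = 0) :
  argmin setT (fun y => enorm (B *m y - c)) = [set mpinv B *m c].
Proof.
set x := mpinv B *m c.
have pyth y : enorm (B *m y - c) ^+ 2 =
    enorm (B *m (y - x)) ^+ 2 + enorm (B *m x - c) ^+ 2.
  rewrite -enorm_pythagoras; first by rewrite mulmxBr addrA subrK.
  by rewrite trmx_mul -mulmxA mpinv_normal_eq mulmx0.
apply/seteqP; split=> [y [_ ymin] | _ ->].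
- apply/eqP; rewrite -subr_eq0; apply/eqP/Binj/enorm_sqr_eq0/eqP.
  rewrite eq_le sqr_ge0 andbT -(lerD2r (enorm (B *m x - c) ^+ 2)) add0r.
  by rewrite -pyth ler_pXn2r ?nnegrE ?enorm_ge0 //; exact: ymin.
- split=> // z _; rewrite -(@ler_pXn2r _ 2) ?nnegrE ?enorm_ge0 //.
  by rewrite [leRHS]pyth lerDr sqr_ge0.
Qed.

Lemma argmin_set1 (R : realType) (T : Type) (x : T) (f : T -> R) :
  argmin [set x] f = [set x].
Proof. by apply/seteqP; split=> [y [] | _ ->] //; split=> // _ ->. Qed.

(** The first [k] rows of [Bmx] form a triangular matrix with determinant
    [alpha_1 * ... * alpha_k]. *)
Lemma Bmx_inj (R : realType) (k : nat) (alpha beta : nat -> R)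
    (alpha_neq0 : forall i, (1 <= i <= k)%N -> alpha i != 0) (y : 'cV[R]_k) :
  Bmx k alpha beta *m y = 0 -> y = 0.
Proof.
pose T := rowsub (widen_ord (leqnSn k)) (Bmx k alpha beta).
have Tunit : T \in unitmx.
  rewrite unitmxE unitfE det_trig.
    apply/prodf_neq0 => i _; rewrite !mxE eqxx.
    by apply: alpha_neq0; exact: ltn_ord.
  apply/is_trig_mxP => i j ij; rewrite !mxE /=.
  by rewrite (ltn_eqF ij) (ltn_eqF (leqW ij)).
move=> By0; have Ty0 : T *m y = 0.
  by rewrite mul_rowsub_mx By0; apply/matrixP => i j; rewrite !mxE.
by rewrite -(mulKmx Tunit y) Ty0 mulmx0.
Qed.

Theorem theorem4p1 (R : realType) (m n p k : nat)
    (A : 'M[R]_(m, n)) (L : 'M[R]_(p, n)) (b : 'cV[R]_m)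
    (QA : 'M[R]_(m, n)) (QL : 'M[R]_(p, n)) (Rf : 'M[R]_n)
    (u : nat -> 'cV[R]_m) (v : nat -> 'cV[R]_n) (uh : nat -> 'cV[R]_p)
    (alpha beta alphah betah : nat -> R)
    (hmn : (n <= m)%N)
    (hAL : forall x : 'cV[R]_n, A *m x = 0 -> L *m x = 0 -> x = 0)
    (hb : b != 0)
    (hqr : compact_qr A L QA QL Rf)
    (hk : (k <= minn n p)%N)
    (hjbd : jbd_process QA QL b k u v uh alpha beta alphah betah)
    (hnb : no_breakdown k alpha beta alphah) :
  let B := Bmx k alpha beta in
  let Bbar := Bbarmx k alphah betah in
  let e1 : 'cV[R]_(k.+1) := delta_mx ord0 ord0 in
  let residual := fun y : 'cV[R]_k => enorm (B *m y - beta 1%N *: e1) in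
  let yk := beta 1%N *: (mpinv B *m e1) in
  argmin (argmin setT residual) (fun y => enorm (Bbar *m y)) = [set yk] /\
  argmin setT residual = [set yk].
Proof.
move=> B Bbar e1 residual yk.
have lsq : argmin setT residual = [set yk].
  rewrite /yk scalemxAr; apply: argmin_lsq_mpinv => y.
  by apply: Bmx_inj => i /hnb [].
by split=> //; rewrite lsq argmin_set1.
Qed.
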